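(* Let $f(x)=\ln(e-x)$ for $0\le x\le e-1$ and $f(x)=0$ for $x>e-1$. Then $f$ is a standard allocation rule and the large-market approximation ratio of the mechanism $\mathrm{Truthful}(f)$ equals $1-1/e$. Moreover, for every standard allocation rule $g$, the large-market approximation ratio of $\mathrm{Truthful}(g)$ is at most $1-1/e$. (Thus $f$ is an optimal choice of standard allocation rule for this family of mechanisms.)
   Context: Setting (budgeted procurement with divisible items): a buyer with budget $B>0$ faces a finite set $S=\{1,\dots,n\}$ of sellers; seller $i$ owns one item that gives the buyer utility $u_i>0$ and has a private cost $c_i\ge 0$. Items are divisible: buying a fraction $x_i\in[0,1]$ of item $i$ costs seller $i$ the amount $x_ic_i$ and gives the buyer utility $x_iu_i$. $U^\star$ denotes the optimal fractional knapsack value $\max\{\sum_i u_i\alpha_i:\alpha\in[0,1]^n,\ \sum_i c_i\alpha_i\le B\}$. Let $c_{\max}=\max_i c_i$ and call $\theta=c_{\max}/B$ the largeness ratio of the instance. A standard allocation rule is a non-increasing function $f:[0,\infty)\to[0,1]$ with $f(0)=1$ and $f(e-1)=0$ (hence $f(x)=0$ for $x\ge e-1$). For $r>0$ let $f_r(x)=f(x/r)$, let $Q_r(x)=x f_r(x)+\int_x^\infty f_r(y)\,dy$ for $x\ge 0$, and let $P_{i,r}(x)=u_iQ_r(x/u_i)$. Mechanism $\mathrm{EnvyFree}(f)$ on cost vector $c$: the stopping rate $r^\star(c)$ is the value at which, starting from $r=\infty$ and decreasing $r$, the total payment $\sum_{i\in S}P_{i,r}(c_i)$ (a nondecreasing function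 of $r$) first becomes equal to $B$; it buys $f_{r^\star}(c_i/u_i)$ of item $i$ and pays $P_{i,r^\star}(c_i)$ to seller $i$. Mechanism $\mathrm{Truthful}(f)$ on cost vector $c$: for each seller $i$, let $r_i$ be the stopping rate of $\mathrm{EnvyFree}(f)$ on the cost vector obtained from $c$ by replacing $c_i$ with $0$ (all other costs unchanged); buy $f_{r_i}(c_i/u_i)$ of item $i$ and pay $P_{i,r_i}(c_i)$ to seller $i$. Large-market approximation ratio of a mechanism $M$ (evaluated with true costs): $\lim_{\theta_0\to 0}\ \inf_I \mathcal U_M(I)/U^\star(I)$, where the infimum is over instances $I$ with largeness ratio at most $\theta_0$ and $\mathcal U_M(I)=\sum_i u_ix_i$ is the buyer's utility from $M$'s allocation. *)

(* Defs.v *)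
From HB Require Import structures.
From mathcomp Require Import all_boot all_order all_algebra.
From mathcomp Require Import all_classical all_reals all_analysis.
Set Implicit Arguments. Unset Strict Implicit. Unset Printing Implicit Defensive.
Import Order.TTheory GRing.Theory Num.Theory.
Import numFieldNormedType.Exports.
Local Open Scope classical_set_scope.
Local Open Scope ring_scope.

Section Defs.
Variable R : realType.

Definition euler : R := expR 1.

(** Standard allocation rule: f : [0,oo) -> [0,1] non-increasing,
    f 0 = 1, f (e-1) = 0 (values on negative arguments are irrelevant). *)
Definition standard_rule (f : R -> R) : Prop :=
  [/\ (forall x, 0 <= x -> 0 <= f x <= 1),
      (forall x y, 0 <= x -> x <= y -> f y <= f x),
      f 0 = 1 & f (euler - 1) = 0].

Definition frate (f : R -> R) (r x : R) : R := f (x / r).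

Definition Qr (f : R -> R) (r x : R) : R :=
  x * frate f r x + Rintegral lebesgue_measure `[x, +oo[ (frate f r).

Definition Pr (f : R -> R) (r ui x : R) : R := ui * Qr f r (x / ui).

Definition total_payment (f : R -> R) n (u c : 'I_n -> R) (r : R) : R :=
  \sum_(i < n) Pr f r (u i) (c i).

(** Rates r > 0 at which the total payment is at most B.  The stopping rate
    of EnvyFree(f) ("decreasing r from oo, the first r at which the
    nondecreasing total payment equals B") is the supremum of this set. *)
Definition stop_set (f : R -> R) n (u c : 'I_n -> R) (B : R) : set R :=
  [set r | 0 < r /\ total_payment f u c r <= B].

Definition stopping_rate (f : R -> R) n (u c : 'I_n -> R) (B : R) : R :=
  sup (stop_set f u c B).

(** a (deterministic) mechanism, described by its allocation:
    number of sellers, utilities, costs, budget  |->  fractions bought *)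
Definition mechanism := forall n : nat, ('I_n -> R) -> ('I_n -> R) -> R -> 'I_n -> R.

Definition zero_at n (c : 'I_n -> R) (i : 'I_n) : 'I_n -> R :=
  fun j => if j == i then 0 else c j.

(** Truthful(f): seller i gets f_{r_i}(c_i/u_i), r_i the stopping rate of
    EnvyFree(f) on (0, c_{-i}).  Convention (degenerate case only): if the
    total payment never reaches B (stop set unbounded), nothing is bought. *)
Definition truthful (f : R -> R) : mechanism :=
  fun n u c B i =>
    let S := stop_set f u (zero_at c i) B in
    if `[< has_ubound S >] then frate f (sup S) (c i / u i) else 0.

Definition mech_utility (M : mechanism) n (u c : 'I_n -> R) (B : R) : R :=
  \sum_(i < n) u i * M n u c B i.

Definition Ustar n (u c : 'I_n -> R) (B : R) : R :=
  sup [set v | exists a : 'I_n -> R,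
         (forall i, 0 <= a i <= 1) /\ \sum_(i < n) c i * a i <= B /\
         v = \sum_(i < n) u i * a i].

Definition valid_instance n (u c : 'I_n -> R) (B : R) : Prop :=
  (0 < n)%N /\ 0 < B /\ (forall i, 0 < u i) /\ (forall i, 0 <= c i).

Definition largeness n (c : 'I_n -> R) (B : R) : R :=
  (\big[Num.max/0]_(i < n) c i) / B.

Definition worst_ratio (M : mechanism) (theta0 : R) : \bar R :=
  ereal_inf [set x | exists n (u c : 'I_n -> R) (B : R),
    valid_instance u c B /\ largeness c B <= theta0 /\
    x = (mech_utility M u c B / Ustar u c B)%:E].

Definition large_market_ratio_is (M : mechanism) (l : \bar R) : Prop :=
  worst_ratio M x @[x --> 0^'+] --> l.

Definition f_ln (x : R) : R := if x <= euler - 1 then ln (euler - x) else 0.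

End Defs.

(* Main.v *)
Require Import Defs.
From HB Require Import structures.
From mathcomp Require Import all_boot all_order all_algebra.
From mathcomp Require Import all_classical all_reals all_analysis.
From mathcomp Require Import measurable_realfun ring lra.
Import Order.TTheory GRing.Theory Num.Theory.
Import numFieldNormedType.Exports.
Local Open Scope classical_set_scope.
Local Open Scope ring_scope.
Set Implicit Arguments. Unset Strict Implicit. Unset Printing Implicit Defensive.

(* Lower bound for f = f_ln: integrating f gives e f(x) = Q(x) + max(0, e-1-x)
   pointwise.  Summed over the sellers this says that the utility at rate r is
   (1 - 1/e) times the value of the dual of the fractional knapsack problem at
   threshold rate r (e - 1), with the payment in place of the budget.  Zeroing
   the cost of seller i changes the total payment by at most (e - 1) c_i, so at
   the smallest of the rates r_i the payment is still at least
   (1 - (e - 1) theta) B, and monotonicity of f concludes.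

   Upper bound for an arbitrary rule: when rates are distributed on [0, e - 1]
   according to 1 / (e - x), the virtual cost is constantly e on positive costs,
   so whatever the rule and the rate, the utility gained from positive-cost
   sellers is at most 1/e of the payment.  With the budget equal to the total
   cost, (e - 2) per seller, the utility is at most 1/e + (e - 2)/e per seller
   while the optimum buys everything. *)

(** * Payments of a standard rule *)

Section StandardRule.
Variable R : realType.
Local Notation e := (@euler R).
Local Notation mu := (@lebesgue_measure R).

Lemma euler_gt2 : 2 < e.
Proof.
have := @expR_gt1Dx R 1 (oner_neq0 _).
by rewrite /euler; lra.
Qed.

Implicit Types (r x y a b : R).

Variables (g : R -> R) (hg : standard_rule g).

Lemma rule_ge0 x : 0 <= x -> 0 <= g x.
Proof. by case: hg => + _ _ _ x0 => /(_ _ x0)/andP[]. Qed.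

Lemma rule_le1 x : 0 <= x -> g x <= 1.
Proof. by case: hg => + _ _ _ x0 => /(_ _ x0)/andP[]. Qed.

Lemma rule_noninc x y : 0 <= x -> x <= y -> g y <= g x.
Proof. by case: hg => _ + _ _; exact. Qed.

Lemma rule_eq0 x : e - 1 <= x -> g x = 0.
Proof.
move=> ex; have e2 := euler_gt2.
have [_ _ _ ge1] := hg; apply/eqP; rewrite eq_le rule_ge0 ?andbT; last lra.
by rewrite -ge1 rule_noninc//; lra.
Qed.

Definition tail (r x : R) : R := \int[mu]_(y in `[x, +oo[) frate g r y.

Lemma QrE r x : Qr g r x = x * g (x / r) + tail r x.
Proof. by []. Qed.

Lemma frate_measurable r x : 0 < r -> 0 <= x ->
  measurable_fun `[x, +oo[ (frate g r).
Proof.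
move=> r0 x0.
(* A rule is arbitrary at negative arguments; composing with [Num.max 0] yields a function that is
   monotone on the whole line, hence measurable. *)
apply: (@eq_measurable_fun _ _ _ _ _ (fun y => g (Num.max 0 y / r))).
  move=> y; rewrite inE/= in_itv/= andbT => xy.
  by rewrite /frate max_r// (le_trans x0).
apply: nonincreasing_measurable => // y z yz.
have m0 : 0 <= Num.max 0 y by rewrite le_max lexx.
apply: rule_noninc; first by rewrite divr_ge0// ltW.
rewrite ler_pM2r ?invr_gt0// ge_max !le_max lexx/=.
by rewrite yz orbT.
Qed.

Lemma frate_integrable r x : 0 < r -> 0 <= x ->
  mu.-integrable `[x, +oo[ (EFin \o frate g r).
Proof.
move=> r0 x0.
have e2 := euler_gt2.
apply: (@le_integrable _ _ _ mu _ _ _ (EFin \o \1_(`[0, r * (e - 1)]%classic))).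
- exact: measurable_itv.
- by apply/measurable_EFinP; exact: frate_measurable.
- move=> y /=; rewrite in_itv/= andbT => xy.
  have y0 : 0 <= y by exact: le_trans xy.
  have yr0 : 0 <= y / r by rewrite divr_ge0// ltW.
  rewrite lee_fin /frate (ger0_norm (rule_ge0 yr0)) indicE mem_setE in_itv/= y0/=.
  have [yr|ry] := leP y (r * (e - 1)).
    by rewrite normr1 rule_le1.
  by rewrite normr0 rule_eq0// ler_pdivlMr// mulrC ltW.
- apply: (@integrableS _ _ _ _ setT) => //.
  exact: integrable_indic_itv.
Qed.

Lemma tail_split r a b : 0 < r -> 0 <= a -> a <= b ->
  tail r a = \int[mu]_(y in `[a, b]) frate g r y + tail r b.
Proof.
move=> r0 a0 ab.
rewrite /tail -(@Rintegral_itv_obnd_cbnd _ b); last first.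
  apply: integrableS (frate_integrable r0 (le_trans a0 ab)) => //.
  by apply: subset_itvr; rewrite bnd_simp.
rewrite -(@Rintegral_itvB _ _ (BLeft a) _ b) ?bnd_simp//; first by rewrite addrC subrK.
exact: frate_integrable.
Qed.

Lemma frate_integrable_itv r a b : 0 < r -> 0 <= a ->
  mu.-integrable `[a, b] (EFin \o frate g r).
Proof.
move=> r0 a0; apply: integrableS (frate_integrable r0 a0) => //.
by apply: subset_itvl; rewrite bnd_simp.
Qed.

Lemma Rintegral_cst_itv (a b k : R) : a <= b ->
  \int[mu]_(y in `[a, b]) k = (b - a) * k.
Proof.
move=> ab; rewrite Rintegral_cst//= lebesgue_measure_itv/= lte_fin.
have [_|ba] := ltP a b; first by rewrite mulrC.
by rewrite (@le_anti _ _ a b) ?ab ?ba// subrr mul0r mulr0.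
Qed.

Lemma cst_integrable_itv (a b k : R) : mu.-integrable `[a, b] (EFin \o fun=> k).
Proof.
apply: measurable_bounded_integrable => //.
  by rewrite /= lebesgue_measure_itv/= lte_fin; case: ifP => _; rewrite ?ltry.
by apply: bounded_cst.
Qed.

(** On [[a, b]] the integrand is at least its value at [b]. This is the only property of the
    integral behind the monotonicity of payments and the virtual cost bound. *)
Lemma tail_step r a b : 0 < r -> 0 <= a -> a <= b ->
  (b - a) * g (b / r) + tail r b <= tail r a.
Proof.
move=> r0 a0 ab; rewrite (tail_split r0 a0 ab) lerD2r.
rewrite -(Rintegral_cst_itv (g (b / r)) ab).
apply: le_Rintegral => //=.
- exact: cst_integrable_itv.
- exact: frate_integrable_itv.
- move=> y; rewrite in_itv/= => /andP[ay yb]; apply: rule_noninc.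
    by rewrite divr_ge0 ?(ltW r0)// (le_trans a0).
  by rewrite ler_pM2r ?invr_gt0.
Qed.

Lemma tail_ge0 r x : 0 < r -> 0 <= x -> 0 <= tail r x.
Proof.
move=> r0 x0; apply: Rintegral_ge0 => y /=; rewrite in_itv/= andbT => xy.
by rewrite rule_ge0// divr_ge0 ?(ltW r0)// (le_trans x0).
Qed.

Lemma tail_eq0 r x : 0 < r -> r * (e - 1) <= x -> tail r x = 0.
Proof.
move=> r0 rx; rewrite /tail (@eq_Rintegral _ _ _ _ _ (fun=> 0)).
  by rewrite Rintegral_cst// mul0r.
move=> y; rewrite inE/= in_itv/= andbT => xy.
by rewrite /frate rule_eq0// ler_pdivlMr// mulrC (le_trans rx).
Qed.

Lemma tail_le r x : 0 < r -> 0 <= x -> tail r x <= r * (e - 1).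
Proof.
move=> r0 x0; have e2 := euler_gt2.
have re0 : 0 <= r * (e - 1) by rewrite mulr_ge0//; lra.
have [xr|rx] := leP x (r * (e - 1)); last by rewrite tail_eq0 ?(ltW rx).
rewrite (tail_split r0 x0 xr) (tail_eq0 r0 (lexx _)) addr0.
apply: (@le_trans _ _ ((r * (e - 1) - x) * 1)); last lra.
rewrite -Rintegral_cst_itv//.
apply: le_Rintegral => //=.
- exact: frate_integrable_itv.
- exact: cst_integrable_itv.
- move=> y; rewrite in_itv/= => /andP[ay yb]; apply: rule_le1.
  by rewrite divr_ge0 ?(ltW r0)// (le_trans x0).
Qed.

Lemma Qr_le_Qr0 r x : 0 < r -> 0 <= x -> Qr g r x <= Qr g r 0.
Proof.
move=> r0 x0; rewrite !QrE mul0r add0r.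
by have := tail_step r0 (lexx _) x0; rewrite subr0.
Qed.

Lemma Qr_ge0 r x : 0 < r -> 0 <= x -> 0 <= Qr g r x.
Proof.
move=> r0 x0; rewrite QrE addr_ge0 ?tail_ge0// mulr_ge0// rule_ge0//.
by rewrite divr_ge0// ltW.
Qed.

Lemma Qr0_le r : 0 < r -> Qr g r 0 <= r * (e - 1).
Proof. by move=> r0; rewrite QrE mul0r add0r tail_le. Qed.

End StandardRule.

(** * Total payments and stop sets *)

Section MarketPayments.
Variables (R : realType) (g : R -> R) (hg : standard_rule g).
Variables (n : nat) (u c : 'I_n -> R) (B : R).
Hypotheses (u_gt0 : forall i, 0 < u i) (c_ge0 : forall i, 0 <= c i).
Local Notation e := (@euler R).

Lemma zero_at_ge0 i j : 0 <= zero_at c i j.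
Proof. by rewrite /zero_at; case: ifP. Qed.

Lemma le_total_payment_zero_at i r : 0 < r ->
  total_payment g u c r <= total_payment g u (zero_at c i) r.
Proof.
move=> r0; apply: ler_sum => j _; rewrite /zero_at; case: eqP => // _.
rewrite /Pr mul0r ler_pM2l ?u_gt0// Qr_le_Qr0//.
by rewrite divr_ge0 ?(ltW (u_gt0 _)).
Qed.

Lemma stop_set_zero_at_sub i : stop_set g u (zero_at c i) B `<=` stop_set g u c B.
Proof.
by move=> r [r0 rB]; split=> //; apply: le_trans rB; exact: le_total_payment_zero_at.
Qed.

Lemma total_payment_le r : 0 < r ->
  total_payment g u c r <= (\sum_(i < n) u i) * (r * (e - 1)).
Proof.
move=> r0; rewrite mulr_suml; apply: ler_sum => i _.
rewrite /Pr ler_pM2l ?u_gt0//; apply: le_trans (Qr0_le hg r0).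
by rewrite Qr_le_Qr0// divr_ge0 ?(ltW (u_gt0 _)).
Qed.

Lemma stop_set_neq0 : 0 < B -> stop_set g u c B !=set0.
Proof.
move=> B0; have e2 := euler_gt2 R.
have U0 : 0 <= \sum_(i < n) u i by apply: sumr_ge0 => i _; exact: ltW.
set U := \sum_(i < n) u i in U0.
have D0 : 0 < 1 + U * (e - 1) by rewrite ltr_pwDl// mulr_ge0//; lra.
(* The total payment is at most [U * (e - 1) * r]; the added 1 keeps the denominator positive even
   when there are no sellers. *)
exists (B / (1 + U * (e - 1))).
have r0 : 0 < B / (1 + U * (e - 1)) by rewrite divr_gt0.
split=> //; apply: le_trans (total_payment_le r0) _.
rewrite -/U mulrCA mulrAC ler_pdivrMr// ler_pM2l//; lra.
Qed.

End MarketPayments.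

(** For a discontinuous rule the stopping rate may fail to belong to the stop set. Lowering the cost
    slightly, from [c i] to [c'], makes room for a genuine member just below the supremum. That
    member also lies in the stop set of [c], since zeroing a cost only raises payments. *)
Lemma truthful_le (R : realType) (g : R -> R) (n : nat) (u c : 'I_n -> R)
    (B : R) (i : 'I_n) (c' : R) :
  standard_rule g -> 0 < B -> (forall j, 0 < u j) -> (forall j, 0 <= c j) ->
  0 <= c' -> c' = 0 \/ c' < c i ->
  exists2 r, stop_set g u c B r & truthful g u c B i <= g (c' / u i / r).
Proof.
move=> hg B0 u0 c0 c'0 c'c.
have Sneq0 := stop_set_neq0 hg u0 (zero_at_ge0 c0 i) B0.
have Ssub := @stop_set_zero_at_sub _ _ hg _ _ _ B u0 c0 i.
have [s Ss] := Sneq0; have [s0 _] := Ss.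
have c'u0 : 0 <= c' / u i by rewrite divr_ge0 ?(ltW (u0 _)).
rewrite /truthful; case: asboolP => [ubS|_]; last first.
  by exists s; [exact: Ssub|rewrite rule_ge0// divr_ge0// ltW].
set S := stop_set g u (zero_at c i) B in Sneq0 Ssub Ss ubS *.
have sup0 : 0 < sup S by rewrite (lt_le_trans s0)// ub_le_sup.
have ciu0 : 0 <= c i / u i by rewrite divr_ge0 ?(ltW (u0 _)).
case: c'c => [->|c'c].
  exists s; first exact: Ssub.
  rewrite !mul0r; have [_ _ -> _] := hg.
  by rewrite /frate rule_le1// divr_ge0// ltW.
have ci0 : 0 < c i by exact: le_lt_trans c'c.
(* The slack is chosen so that [r] exceeds [sup S * c' / c i], that is, [c' / r < c i / sup S]. *)
have [|r Sr] := @sup_adherent _ S (sup S * (1 - c' / c i)) _ (conj Sneq0 ubS).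
  by rewrite mulr_gt0// subr_gt0 ltr_pdivrMr// mul1r.
rewrite mulrBr mulr1 opprB addrC subrK => ltr.
exists r; first exact: Ssub.
have [r0 _] := Sr.
rewrite /frate; apply: rule_noninc => //; first by rewrite divr_ge0// ltW.
rewrite ler_pdivrMr// mulrAC ler_pdivlMr// mulrAC [leRHS]mulrAC.
rewrite ler_pM2r ?invr_gt0//.
move: ltr; rewrite mulrA ltr_pdivrMr// => /ltW.
by rewrite mulrC [r * _]mulrC.
Qed.

(** * Sellers of equal utility in order of cost *)

Section SortedCosts.
Variables (R : realType) (g : R -> R) (hg : standard_rule g).
Variables (c : nat -> R).
Hypotheses (c_ge0 : forall k, 0 <= c k) (c_nd : forall k, c k <= c k.+1).

(* Every cost gap below the k-th seller is charged at least g (c k / r) once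
   per cheaper seller: the coefficient is the discrete virtual cost. *)
Lemma sum_Qr_ge r m : 0 < r ->
  \sum_(k < m.+1) g (c k / r) * (k.+1%:R * c k - k%:R * c k.-1)
    + m.+1%:R * tail g r (c m) <= \sum_(k < m.+1) Qr g r (c k).
Proof.
move=> r0; elim: m => [|m IHm].
  by rewrite !big_ord_recr !big_ord0/= QrE; lra.
rewrite big_ord_recr [leRHS]big_ord_recr/= QrE.
have := tail_step hg r0 (c_ge0 m) (c_nd m).
move=> /(ler_wpM2l (ler0n R m.+1)).
move: IHm; rewrite -[m.+2%:R]natr1.
set x := \sum_(k < _) _; set y := \sum_(k < _) _; set a := m.+1%:R.
move: (tail _ _ _) (tail _ _ _) => t t'.
lra.
Qed.

(** Each seller is compared with its predecessor's cost, as [truthful_le] requires a smaller or zero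
    one. The shift of index costs at most 1, the allocation of the first seller. *)
Lemma truthful_shift m (B : R) : 0 < B ->
  (forall k, (k < m)%N -> c k = 0 \/ c k < c k.+1) ->
  exists2 r, stop_set g (fun=> 1) (fun i : 'I_m.+1 => c i) B r &
    \sum_(i < m.+1) truthful g (fun=> 1) (fun i : 'I_m.+1 => c i) B i <=
    1 + \sum_(k < m.+1) g (c k / r).
Proof.
move=> B0 c_inc.
set C := fun i : 'I_m.+1 => c i.
pose p (i : 'I_m.+1) : R := if i == ord0 then 0 else c i.-1.
have p_ge0 i : 0 <= p i by rewrite /p; case: ifP.
have /fin_all_exists [r hr] : forall i : 'I_m.+1, exists r : R,
    stop_set g (fun=> 1) C B r /\ truthful g (fun=> 1) C B i <= g (p i / r).
  move=> i; have [||r Sr] := @truthful_le _ g _ (fun=> 1) C B i (p i) hg B0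
    (fun=> ltr01) (fun=> c_ge0 _).
  - exact: p_ge0.
  - rewrite /p; case: eqP => [_|/eqP i0]; first by left.
    have i_gt0 : (0 < i)%N by rewrite lt0n; move: i0; rewrite -val_eqE.
    have i1 : nat_of_ord i = i.-1.+1 by rewrite prednK.
    have im : (i.-1 < m)%N by rewrite -ltnS -i1.
    by have := c_inc _ im; rewrite -i1.
  by rewrite divr1; exists r.
(* A maximum of finitely many members of the stop set is one of them, and a higher rate only
   increases every allocation. *)
pose s := \big[Num.max/r ord0]_i r i.
have Ss : stop_set g (fun=> 1) C B s.
  apply: big_ind => [|x y Sx Sy|i _]; first by case: (hr ord0).
  - by rewrite maxEle; case: ifP.
  - by case: (hr i).
have s0 : 0 < s by case: Ss.
exists s => //.
have alloc i : truthful g (fun=> 1) C B i <= g (p i / s).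
  have [[ri0 _] h] := hr i; apply: le_trans h _; apply: rule_noninc => //.
    by rewrite divr_ge0 ?(ltW s0).
  by rewrite ler_wpM2l// lef_pV2 ?posrE// /s le_bigmax.
rewrite big_ord_recl lerD//.
  apply: le_trans (alloc _) _; rewrite /p eqxx mul0r.
  by rewrite rule_le1.
rewrite [leRHS]big_ord_recr/= ler_wpDr//.
  by rewrite rule_ge0// divr_ge0// ltW.
apply: ler_sum => i _; exact: alloc.
Qed.

End SortedCosts.

(** * The worst-case instance *)

Section HardInstance.
Variable R : realType.
Local Notation e := (@euler R).

(* Discretization of the distribution function 1 / (e - x) on [0, e - 1], for
   which the virtual cost of every seller of positive cost is the constant e. *)
Definition hard_cost (n k : nat) : R := Num.max 0 (e - n%:R / k.+1%:R).

Lemma hard_cost_ge0 n k : 0 <= hard_cost n k.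
Proof. by rewrite /hard_cost le_max lexx. Qed.

Lemma hard_cost_nd n k : hard_cost n k <= hard_cost n k.+1.
Proof.
rewrite /hard_cost ge_max !le_max lexx/= lerD2l lerN2; apply/orP; right.
by rewrite ler_wpM2l ?ler0n// lef_pV2 ?posrE ?ltr0n// ler_nat.
Qed.

Lemma hard_cost_lt n k : (0 < n)%N ->
  hard_cost n k = 0 \/ hard_cost n k < hard_cost n k.+1.
Proof.
move=> n0; rewrite /hard_cost.
case: (leP (e - n%:R / k.+1%:R) 0) => h; [by left|right].
rewrite lt_max ltrD2l ltrN2 ltr_pM2l ?ltr0n//.
by rewrite ltf_pV2 ?posrE ?ltr0n// ltr_nat ltnSn orbT.
Qed.

Lemma hard_cost_le n k : (k < n)%N -> hard_cost n k <= e - 1.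
Proof.
move=> kn; have e2 := euler_gt2 R.
rewrite /hard_cost ge_max; apply/andP; split; first lra.
by rewrite lerD2l lerN2 ler_pdivlMr ?ltr0n// mul1r ler_nat.
Qed.

(** The number of sellers of cost zero, matching the atom of mass 1/e at 0 of the distribution 1 /
    (e - x). *)
Definition hard_threshold (n : nat) : nat := Num.truncn (n%:R / e).
Local Notation thr := hard_threshold.

Lemma hard_threshold_le n : (thr n)%:R <= n%:R / e.
Proof. by rewrite /hard_threshold truncn_le divr_ge0 ?ler0n// expR_ge0. Qed.

Lemma hard_cost_eq0 n k : (k < thr n)%N -> hard_cost n k = 0.
Proof.
move=> kn; have e2 := euler_gt2 R.
apply/max_idPl; rewrite subr_le0 ler_pdivlMr ?ltr0n//.
rewrite mulrC -ler_pdivlMr; last lra.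
by apply: le_trans (hard_threshold_le n); rewrite ler_nat.
Qed.

Lemma hard_costE n k : (thr n <= k)%N -> hard_cost n k = e - n%:R / k.+1%:R.
Proof.
move=> kn; have e2 := euler_gt2 R.
apply/max_idPr; rewrite subr_ge0 ler_pdivrMr ?ltr0n//.
rewrite mulrC -ler_pdivrMr; last lra.
apply: le_trans (ltW (truncnS_gt _)) _.
by rewrite ler_nat ltnS.
Qed.

(** The terms in [n] cancel. The inequality is strict because the predecessor of [k] must also lie
    at or beyond the threshold, where the cost is not truncated. *)
Lemma virtual_hard_cost n k : (thr n < k)%N ->
  k.+1%:R * hard_cost n k - k%:R * hard_cost n k.-1 = e.
Proof.
move=> nk; case: k nk => // k nk.
rewrite /= !hard_costE// ?(ltnW nk)//.
rewrite !mulrBr (mulrCA k.+2%:R) (mulrCA k.+1%:R) !divff ?pnatr_eq0//.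
by rewrite -[k.+2%:R]natr1; lra.
Qed.

(** Beyond the threshold the costs sum to a linear term minus [n] times a piece of the harmonic
    series, which is bounded below by a difference of logarithms. *)
Lemma sum_hard_cost_le n m : (thr n <= m)%N ->
  \sum_(k < m) hard_cost n k <=
  e * (m%:R - (thr n)%:R) - n%:R * (ln m.+1%:R - ln (thr n).+1%:R).
Proof.
elim: m => [|m IHm].
  rewrite leqn0 => /eqP ->; rewrite big_ord0 !subrr !mulr0 subr0//.
rewrite leq_eqVlt => /predU1P[<-|].
  rewrite !subrr !mulr0 subr0 big1// => k _; exact: hard_cost_eq0.
rewrite ltnS => /[dup] nm /IHm {}IHm.
rewrite big_ord_recr/= hard_costE//.
have lnS : ln (m.+2%:R : R) - ln m.+1%:R <= m.+1%:R^-1.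
  rewrite -ln_div ?posrE ?ltr0n//.
  rewrite -[m.+2%:R]natr1 mulrDl divff ?pnatr_eq0// mul1r.
  by apply: le_ln1Dx; apply: (@lt_trans _ _ 0); rewrite ?ltrN10 ?invr_gt0 ?ltr0n.
move/(ler_wpM2l (ler0n R n)) : lnS.
have := congr1 ( *%R e) (@natr1 R m); rewrite mulrDr mulr1.
move: IHm; set x := \sum_(i < _) _.
move: x (ln _) (ln _) (ln _) (n%:R / m.+1%:R) => x L0 L1 L2 q.
by move: (m.+1%:R : R) => M; lra.
Qed.

(** Charging [e] to each of the first [thr n + 1] sellers adds a term [e * thr n] that cancels
    against the one in the bound on [B]. Of the constant 3, one unit pays for the shift of index and
    the rest for rounding. *)
Lemma truthful_hard_le (g : R -> R) (n : nat) : standard_rule g -> (0 < n)%N ->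
  let c := fun i : 'I_n => hard_cost n i in
  let B := \sum_(i < n) c i in
  0 < B ->
  mech_utility (truthful g) (fun=> 1) c B <= n%:R * (1 - expR (-1)) + 3.
Proof.
move=> hg; case: n => // m n0.
set n := m.+1 => c B B0; have e2 := euler_gt2 R.
have e0 : 0 < e by lra.
have [r [r0 rB] Ule] := @truthful_shift R g hg (hard_cost n) (hard_cost_ge0 n)
  m B B0 (fun k _ => hard_cost_lt k n0).
rewrite /mech_utility (eq_bigr (fun i => truthful g (fun=> 1) c B i)); last first.
  by move=> i _; rewrite mul1r.
apply: le_trans Ule _.
set G := \sum_(k < _) _.
have rB' : \sum_(k < n) Qr g r (hard_cost n k) <= B.
  move: rB; rewrite /total_payment (eq_bigr (fun i : 'I_n => Qr g r (hard_cost n i)))//.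
  by move=> i _; rewrite /Pr divr1 mul1r.
have thrn : (thr n <= m)%N.
  rewrite -ltnS -/n -(ltr_nat R); apply: le_lt_trans (hard_threshold_le n) _.
  by rewrite ltr_pdivrMr// ltr_pMr ?ltr0n//; lra.
have eG : e * G <= B + e * (thr n).+1%:R.
  have := sum_Qr_ge hg (hard_cost_ge0 n) (hard_cost_nd n) m r0.
  move=> /le_trans/(_ rB').
  have t0 : 0 <= m.+1%:R * tail g r (hard_cost n m).
    by rewrite mulr_ge0 ?ler0n// tail_ge0// hard_cost_ge0.
  move=> h; have {t0}h := le_trans (ler_wpDr t0 (lexx _)) h.
  (* Past the threshold the virtual cost is exactly [e]; up to it the virtual cost is only known to
     be nonnegative, so a full [e] is added. *)
  apply: (@le_trans _ _ (\sum_(k < n) (g (hard_cost n k / r) *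
     (k.+1%:R * hard_cost n k - k%:R * hard_cost n k.-1)
     + (k <= thr n)%N%:R * e))).
    rewrite /G mulr_sumr; apply: ler_sum => k _.
    have gk0 : 0 <= g (hard_cost n k / r).
      by rewrite rule_ge0// divr_ge0 ?hard_cost_ge0// ltW.
    have gk1 : g (hard_cost n k / r) <= 1.
      by rewrite rule_le1// divr_ge0 ?hard_cost_ge0// ltW.
    have [kn|nk] := leqP k (thr n); last first.
      by rewrite virtual_hard_cost// mul0r addr0 mulrC.
    rewrite mul1r; apply: ler_wpDl; last first.
      by rewrite ger_pMr.
    rewrite mulr_ge0// subr_ge0 ler_pM ?ler0n ?hard_cost_ge0 ?ler_nat//.
    case: (nat_of_ord k) => // j; exact: hard_cost_nd.
  rewrite big_split/= lerD// -mulr_suml mulrC ler_wpM2l ?(ltW e0)//.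
  rewrite -natr_sum ler_nat.
  rewrite -(big_mkord xpredT (fun k => nat_of_bool (k <= thr n)%N)).
  rewrite (@big_cat_nat _ _ _ (thr n).+1)//=.
  rewrite [X in (_ + X)%N]big_nat_cond [X in (_ + X)%N]big1 ?addn0; last first.
    by move=> i; rewrite andbT => /andP[ni _]; rewrite leqNgt ni.
  apply: (@leq_trans (\sum_(0 <= i < (thr n).+1) 1)%N).
    by apply: leq_sum => i _; exact: leq_b1.
  by rewrite sum_nat_const_nat subn0 muln1.
have Ble : B <= e * (n%:R - (thr n)%:R) - n%:R * (ln n.+1%:R - ln (thr n).+1%:R).
  by apply: sum_hard_cost_le; exact: leqW.
have n1 : 0 < n.+1%:R :> R by rewrite ltr0n.
(* From [e * thr n <= n] follows [e * (thr n + 1) <= (n + 1) + (e - 1)]; divide by [n + 1] and take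
   logarithms. *)
have lnle : 1 - (e - 1) / n.+1%:R <= ln n.+1%:R - ln (thr n).+1%:R.
  have h : ln (e * ((thr n).+1%:R / n.+1%:R)) <= (e - 1) / n.+1%:R.
    apply: (@le_trans _ _ (ln (1 + (e - 1) / n.+1%:R))).
      rewrite ler_ln ?posrE ?mulr_gt0 ?invr_gt0 ?ltr0n//; last first.
        by rewrite addr_gt0// divr_gt0//; lra.
      rewrite mulrA ler_pdivrMr// mulrDl mul1r divfK ?gt_eqF//.
      rewrite -(natr1 n) -(natr1 (thr n)) mulrDr.
      have := hard_threshold_le n; rewrite ler_pdivlMr//.
      move: (n%:R : R) ((thr n)%:R : R) => x y; lra.
    apply: le_ln1Dx; apply: (@lt_trans _ _ 0); first by rewrite ltrN10.
    by rewrite divr_gt0//; lra.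
  move: h; rewrite lnM ?posrE ?divr_gt0 ?ltr0n// ln_div ?posrE ?ltr0n//.
  rewrite /euler expRK. move: (ln _) (ln _) (_ / _) => x y z; lra.
have nn : n%:R * ((e - 1) / n.+1%:R) <= e - 1.
  rewrite mulrCA -[leRHS]mulr1 ler_wpM2l//; first lra.
  by rewrite ler_pdivrMr// mul1r ler_nat.
rewrite -(ler_pM2l e0) expRN -/e.
have -> : e * (n%:R * (1 - e^-1) + 3) = e * n%:R - n%:R + 3 * e.
  by field; rewrite gt_eqF.
move/(ler_wpM2l (ler0n R n)): lnle.
move: eG Ble nn; rewrite -(natr1 (thr n)).
move: ((thr n)%:R : R) (n%:R : R) (ln n.+1%:R) (ln (_ + 1)) ((e - 1) / _) => t N x y z.
move: (B : R) G => b G; lra.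
Qed.

End HardInstance.

(** * Upper bound for every standard rule *)

Section UpperBound.
Variable R : realType.
Local Notation e := (@euler R).

Lemma Ustar_has_ubound n (u c : 'I_n -> R) B : (forall i, 0 <= u i) ->
  has_ubound [set v | exists a : 'I_n -> R,
    (forall i, 0 <= a i <= 1) /\ \sum_(i < n) c i * a i <= B /\
    v = \sum_(i < n) u i * a i].
Proof.
move=> u0; exists (\sum_(i < n) u i) => _ [a [a01 [_ ->]]].
by apply: ler_sum => i _; rewrite ler_piMr//; case/andP: (a01 i).
Qed.

Lemma worst_ratio_le (g : R -> R) (theta0 : R) : standard_rule g -> 0 < theta0 ->
  (worst_ratio (truthful g) theta0 <= (1 - expR (-1))%:E)%E.
Proof.
move=> hg t0; apply/lee_addgt0Pr => eps eps0.
have e2 := euler_gt2 R.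
(* The first term makes [eps * n] absorb the additive constant 3; the second makes the largeness
   ratio at most [theta0], as costs are at most [e - 1] and the budget is at least [m * (e - 2)]. *)
pose M := 3 / eps + (e - 1) / (theta0 * (e - 2)).
have M0 : 0 <= M.
  by rewrite addr_ge0// divr_ge0 ?ltW// ?mulr_gt0//; lra.
pose m := (Num.truncn M).+1.
have Mm : M < m%:R by exact: truncnS_gt.
have m0 : 0 < m%:R :> R by rewrite ltr0n.
(* In the upper half of the indices [n / (k + 1) <= 2], so each of these [m] sellers costs at least
   [e - 2]. *)
pose n := (m + m)%N.
have n0 : 0 < n%:R :> R by rewrite ltr0n.
pose c := fun i : 'I_n => hard_cost R n i.
pose B := \sum_(i < n) c i.
have mB : m%:R * (e - 2) <= B.
  rewrite /B big_split_ord/= ler_wpDl//.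
    by apply: sumr_ge0 => i _; exact: hard_cost_ge0.
  rewrite mulrC mulr_natr -[X in _ *+ X]card_ord -sumr_const.
  apply: ler_sum => i _; rewrite /c/= /hard_cost le_max lerD2l lerN2.
  rewrite ler_pdivrMr ?ltr0n// -natrM ler_nat mulnC muln2 -addnn.
  by rewrite /n leq_add ?orbT//; apply: leqW; rewrite leq_addr.
have B0 : 0 < B by apply: lt_le_trans mB; rewrite mulr_gt0//; lra.
have UB : n%:R <= Ustar (fun=> 1) c B.
  apply: ub_le_sup; first by apply: Ustar_has_ubound => i.
  exists (fun=> 1); split; first by move=> i; rewrite ler01 lexx.
  split; first by rewrite /B; apply: ler_sum => i _; rewrite mulr1.
  rewrite (eq_bigr (fun=> 1)); last by move=> i _; rewrite mulr1.
  by rewrite sumr_const card_ord.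
apply: ge_ereal_inf.
exists (mech_utility (truthful g) (fun=> 1) c B / Ustar (fun=> 1) c B)%:E.
  exists n, (fun=> 1), c, B; split; last split=> //.
    by split=> //; split=> //; split=> // i; exact: hard_cost_ge0.
  rewrite /largeness ler_pdivrMr//.
  apply: (@le_trans _ _ (e - 1)).
    apply: bigmax_le => [|i _]; first lra.
    exact: hard_cost_le.
  apply: (@le_trans _ _ (theta0 * (m%:R * (e - 2)))); last by rewrite ler_pM2l.
  rewrite mulrCA -ler_pdivrMr; last by rewrite mulr_gt0//; lra.
  apply: le_trans (ltW Mm); rewrite /M lerDr divr_ge0// ltW//.
rewrite -EFinD lee_fin ler_pdivrMr; last exact: lt_le_trans UB.
apply: le_trans (truthful_hard_le hg _ B0) _ => //.
have e1 : expR (-1) < 1 :> R by rewrite expR_lt1 ltrN10.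
apply: (@le_trans _ _ ((1 - expR (-1) + eps) * n%:R)); last first.
  by rewrite ler_wpM2l//; lra.
rewrite mulrDl mulrC lerD2l mulrC -ler_pdivrMr//.
apply: (@le_trans _ _ m%:R); last by rewrite ler_nat leq_addr.
apply: le_trans (ltW Mm); rewrite /M lerDl divr_ge0 ?ltW// ?mulr_gt0//; lra.
Qed.

Lemma worst_ratio_noninc (M : mechanism R) (x y : R) : x <= y ->
  (worst_ratio M y <= worst_ratio M x)%E.
Proof.
move=> xy; apply: ereal_inf_le_tmp => _ [n [u [c [B [v [l ->]]]]]].
exists n, u, c, B; split=> //; split=> //; exact: le_trans xy.
Qed.

(** Shrinking [theta0] leaves fewer instances, so [worst_ratio] is monotone; its limit at 0 is a
    supremum and inherits the bound. *)
Lemma large_market_ratio_exists (M : mechanism R) (b : \bar R) :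
  (forall theta0, 0 < theta0 -> (worst_ratio M theta0 <= b)%E) ->
  exists l, large_market_ratio_is M l /\ (l <= b)%E.
Proof.
move=> Wb; eexists; split.
  apply: (nonincreasing_at_right_cvge (BInfty _ false)) => // x y _ _.
  exact: worst_ratio_noninc.
apply: ge_ereal_sup => _ /= [x + <-]; rewrite in_itv/= andbT; exact: Wb.
Qed.

End UpperBound.

(** * The logarithmic rule *)

Section LogRule.
Variable R : realType.
Local Notation e := (@euler R).
Local Notation f := (@f_ln R).
Local Notation mu := (@lebesgue_measure R).
Implicit Types r x y : R.

(** One formula on both sides of the cutoff, from which continuity and monotonicity can be read
    off. *)
Lemma f_lnE y : f y = ln (Num.max 1 (e - y)).
Proof.
rewrite /f_ln; case: leP => h.
  by rewrite max_r//; lra.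
by rewrite max_l ?ln1//; lra.
Qed.

Lemma continuous_ln_max (h : R -> R) (y : R) : {for y, continuous h} ->
  {for y, continuous (fun z => ln (Num.max 1 (h z)))}.
Proof.
move=> ch; apply: (@continuous_comp _ _ _ (fun z => Num.max 1 (h z)) (@ln R)).
  by apply: (@continuous_max R _ (fun=> 1) h) => //; exact: cvg_cst.
by apply: continuous_ln; rewrite lt_max ltr01.
Qed.

Lemma standard_f_ln : standard_rule f.
Proof.
have e2 := euler_gt2 R.
have m1 y : 1 <= Num.max 1 (e - y) by rewrite le_max lexx.
have m0 y : 0 < Num.max 1 (e - y) by rewrite lt_max ltr01.
split.
- move=> x x0; rewrite f_lnE ln_ge0//=.
  rewrite -[leRHS](@expRK R) ler_ln ?posrE ?expR_gt0// ge_max; apply/andP; split.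
    by rewrite /euler in e2; lra.
  by rewrite -/e; lra.
- move=> x y x0 xy; rewrite !f_lnE ler_ln ?posrE// ge_max !le_max lexx/=.
  by rewrite lerD2l lerN2 xy orbT.
- by rewrite f_lnE subr0 max_r ?expRK//; lra.
- by rewrite f_lnE max_l ?ln1//; lra.
Qed.

Lemma Rintegral_f_ln r x : 0 < r -> 0 <= x -> x < r * (e - 1) ->
  \int[mu]_(y in `[x, r * (e - 1)]) frate f r y =
  r * (1 + (e - x / r) * ln (e - x / r) - (e - x / r)).
Proof.
move=> r0 x0 xr; have e2 := euler_gt2 R.
(* With [t = e - y / r], this is the antiderivative [t * ln t - t] of [ln t], rescaled by
   [dy = - r dt]. *)
pose F y := - r * ((e - y / r) * ln (e - y / r) - (e - y / r)).
have t1 y : y <= r * (e - 1) -> 1 <= e - y / r.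
  by move=> yr; rewrite lerBrDr -lerBrDl ler_pdivrMr// mulrC.
have t0 y : y <= r * (e - 1) -> 0 < e - y / r.
  by move=> /t1; exact: lt_le_trans.
have dF y : y <= r * (e - 1) -> is_derive y 1 F (ln (e - y / r)).
  move=> yr; have ty := t0 _ yr.
  have dl : is_derive (e - y / r) 1 (@ln R) (e - y / r)^-1 by exact: is_derive1_ln.
  have dq : is_derive y 1 (fun y => e - y / r) (- r^-1).
    by apply: is_derive_eq; rewrite scaler0 !add0r mul1r -[_%:A]/(r^-1 * 1) mulr1.
  have dlq : is_derive y 1 (fun y => ln (e - y / r)) (- r^-1 * (e - y / r)^-1).
    rewrite mulrC; apply: (@is_derive1_comp _ (@ln R) (fun y => e - y / r)).
  rewrite /F; apply: is_derive_eq.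
  rewrite /GRing.scale/=; field.
  by rewrite !gt_eqF// subr_gt0 -ltr_pdivrMr// -subr_gt0.
have DF y : y <= r * (e - 1) -> derivable F y 1 by move=> /dF[].
have cF y : y <= r * (e - 1) -> {for y, continuous F}.
  by move=> /DF yr; apply: differentiable_continuous; exact/derivable1_diffP.
have e1 : e - r * (e - 1) / r = 1 by field; rewrite gt_eqF.
rewrite /Rintegral (@continuous_FTC2 _ _ F)//.
- by rewrite -EFinB/= /F e1 ln1; ring.
- apply: continuous_in_subspaceT => y; rewrite inE/= in_itv/= => /andP[_ yr].
  rewrite (_ : frate f r = fun y => ln (Num.max 1 (e - y / r))); last first.
    by apply/funext => z; rewrite /frate f_lnE.
  apply: (@continuous_ln_max (fun y => e - y / r)); apply: cvgB; first exact: cvg_cst.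
  by apply: cvgM; [exact: cvg_id|exact: cvg_cst].
- split.
  + by move=> y; rewrite in_itv/= => /andP[_ /ltW/DF].
  + by apply: cvg_at_right_filter; exact/cF/ltW.
  + by apply: cvg_at_left_filter; exact: cF.
- move=> y; rewrite in_itv/= => /andP[_ yr].
  rewrite derive1E; have -> := @derive_val _ _ _ _ _ _ _ (dF _ (ltW yr)).
  by rewrite /frate f_lnE max_r// t1 ?ltW.
Qed.

Lemma Qr_f_ln r x : 0 < r -> 0 <= x -> let t := Num.max 1 (e - x / r) in
  Qr f r x = r * (e * ln t + 1 - t).
Proof.
move=> r0 x0 t; rewrite QrE f_lnE -/t.
have [xr|rx] := ltP x (r * (e - 1)); last first.
  have t1 : t = 1.
    by rewrite /t max_l// lerBlDr -lerBlDl ler_pdivlMr// mulrC.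
  by rewrite (tail_eq0 standard_f_ln)// t1 ln1; ring.
have tE : t = e - x / r.
  by rewrite /t max_r// lerBrDr -lerBrDl ler_pdivrMr// mulrC ltW.
rewrite (tail_split standard_f_ln r0 x0 (ltW xr)).
rewrite (tail_eq0 standard_f_ln)// Rintegral_f_ln// -tE.
have -> : x = r * (e - t) by rewrite tE; field; rewrite gt_eqF.
ring.
Qed.

Lemma Qr0_f_ln r : 0 < r -> Qr f r 0 = r.
Proof.
move=> r0; have e2 := euler_gt2 R.
rewrite Qr_f_ln// mul0r subr0 max_r; last lra.
by rewrite /euler expRK; ring.
Qed.

(** The bound does not depend on [r]: zeroing one cost perturbs the payment by a multiple of that
    cost, which is small against the budget in a large market. *)
Lemma Qr0_sub_f_ln r x : 0 < r -> 0 <= x -> Qr f r 0 - Qr f r x <= (e - 1) * x.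
Proof.
move=> r0 x0; have e2 := euler_gt2 R.
rewrite Qr0_f_ln// Qr_f_ln//.
set t := Num.max _ _.
have -> : r - r * (e * ln t + 1 - t) = r * (t - e * ln t) by ring.
have -> : (e - 1) * x = r * ((e - 1) * (x / r)) by field; rewrite gt_eqF.
rewrite ler_pM2l//.
have y0 : 0 <= x / r by rewrite divr_ge0// ltW.
rewrite /t; move: (x / r) y0 => y y0 {t}.
have [h|h] := leP 1 (e - y); last by rewrite ln1; nra.
set t := e - y.
have t0 : 0 < t by rewrite /t; lra.
(* This is [ln z <= z - 1] at [z = e / t], tight at zero cost where [t = e]. It turns [t - e * ln t]
   into at most [(e - t) ^+ 2 / t]. *)
have lnt : ln t >= 2 - e / t.
  have et0 : 0 < e / t by rewrite divr_gt0//; lra.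
  have := @le_ln1Dx R (e / t - 1); rewrite (_ : 1 + (e / t - 1) = e / t); last ring.
  rewrite ln_div ?posrE//; last lra.
  rewrite (_ : ln e = 1); last by rewrite /euler expRK.
  by move: (e / t) et0 (ln t) => q q0 l /(_ ltac:(lra)); lra.
apply: (@le_trans _ _ (t - e * (2 - e / t))).
  by rewrite lerD2l lerN2 ler_wpM2l//; lra.
have -> : t - e * (2 - e / t) = y ^+ 2 / t.
  by rewrite (_ : y = e - t); [field; rewrite gt_eqF|rewrite /t; ring].
rewrite ler_pdivrMr//; apply: (@le_trans _ _ ((e - 1) * y)).
  by rewrite expr2 ler_wpM2r//; lra.
by rewrite ler_peMr// mulr_ge0//; lra.
Qed.

(** In terms of [t = Num.max 1 (e - x / r)], this splits [e * ln t] into [e * ln t + 1 - t] and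
    [t - 1]: a payment part and a knapsack dual part. *)
Lemma f_ln_tight r x : 0 < r -> 0 <= x ->
  e * frate f r x = Qr f r x / r + Num.max 0 (e - 1 - x / r).
Proof.
move=> r0 x0; rewrite Qr_f_ln// /frate f_lnE.
have -> : Num.max 0 (e - 1 - x / r) = Num.max 1 (e - x / r) - 1.
  by rewrite addr_maxl subrr addrAC.
by field; rewrite gt_eqF.
Qed.

End LogRule.

(** * Lower bound for the logarithmic rule *)

Section LowerBound.
Variables (R : realType) (n : nat) (u c : 'I_n -> R) (B : R).
Local Notation e := (@euler R).
Local Notation f := (@f_ln R).
Hypotheses (B_gt0 : 0 < B) (u_gt0 : forall i, 0 < u i) (c_ge0 : forall i, 0 <= c i).

Let cu_ge0 i : 0 <= c i / u i.
Proof. by rewrite divr_ge0// ltW. Qed.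

Implicit Types r k : R.

Lemma Ustar_gt0 : (0 < n)%N -> 0 < Ustar u c B.
Proof.
move=> n0; pose C := \sum_(i < n) c i.
have C0 : 0 <= C by apply: sumr_ge0 => i _; exact: c_ge0.
have BC0 : 0 < B + C by rewrite ltr_pwDl.
have U0 : 0 < \sum_(i < n) u i * (B / (B + C)).
  rewrite -mulr_suml mulr_gt0 ?divr_gt0//.
  case: n u u_gt0 n0 => // m v v0 _; rewrite big_ord_recl ltr_pwDl//.
  by apply: sumr_ge0 => i _; exact: ltW.
apply: lt_le_trans U0 _; apply: ub_le_sup.
  by apply: Ustar_has_ubound => i; exact: ltW.
exists (fun=> B / (B + C)); split.
  move=> i; rewrite divr_ge0 ?(ltW B_gt0) ?(ltW BC0)//=.
  by rewrite ler_pdivrMr// mul1r lerDl.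
split=> //; rewrite -mulr_suml -/C mulrCA ler_piMr ?(ltW B_gt0)//.
by rewrite ler_pdivrMr// mul1r lerDr ltW.
Qed.

(* Weak duality for the fractional knapsack, with dual price 1 / (r (e - 1)). *)
Lemma Ustar_le r : 0 < r ->
  (e - 1) * Ustar u c B <=
  B / r + \sum_(i < n) u i * Num.max 0 (e - 1 - c i / u i / r).
Proof.
move=> r0; have e2 := euler_gt2 R.
rewrite mulrC -ler_pdivlMr; last lra.
apply: ge_sup.
  exists 0, (fun=> 0); split; first by move=> i; rewrite lexx ler01.
  by split; [|]; rewrite big1 ?(ltW B_gt0)// => i _; rewrite mulr0.
move=> _ [a [a01 [aB ->]]]; rewrite ler_pdivlMr; last lra.
apply: (@le_trans _ _ ((\sum_(i < n) c i * a i) / r +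
    \sum_(i < n) u i * Num.max 0 (e - 1 - c i / u i / r))); last first.
  by rewrite lerD2r ler_pM2r ?invr_gt0.
rewrite !mulr_suml -big_split/=; apply: ler_sum => i _.
have /andP[a0 a1] := a01 i; have ui := u_gt0 i.
have -> : c i * a i / r = u i * (a i * (c i / u i / r)).
  by field; rewrite !gt_eqF.
rewrite -mulrDr -(mulrA (u i) (a i)) ler_pM2l//.
set x := c i / u i / r; case: (leP 0 (e - 1 - x)) => h; nra.
Qed.

(** By [f_ln_tight], [e] times the utility is payment over [r] plus the dual surplus [V]; since
    [k <= 1] and [V >= 0], this is at least [k] times the dual value. *)
Lemma utility_ge r k : 0 < r -> k <= 1 -> k * B <= total_payment f u c r ->
  (1 - expR (-1)) * k * Ustar u c B <=
  \sum_(i < n) u i * frate f r (c i / u i).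
Proof.
move=> r0 k1 kB; have e2 := euler_gt2 R.
have e0 : 0 < e by lra.
rewrite -(ler_pM2l e0) expRN -/e.
have -> : e * ((1 - e^-1) * k * Ustar u c B) = k * ((e - 1) * Ustar u c B).
  by field; rewrite gt_eqF.
set V := \sum_(i < n) u i * Num.max 0 (e - 1 - c i / u i / r).
have V0 : 0 <= V.
  by apply: sumr_ge0 => i _; rewrite mulr_ge0 ?(ltW (u_gt0 i))// le_max lexx.
have -> : e * (\sum_(i < n) u i * frate f r (c i / u i)) =
    total_payment f u c r / r + V.
  rewrite mulr_sumr mulr_suml -big_split/=; apply: eq_bigr => i _.
  by rewrite mulrCA f_ln_tight// mulrDr /Pr mulrA.
have [k0|k0] := leP 0 k.
  apply: le_trans (ler_wpM2l k0 (Ustar_le r0)) _.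
  rewrite mulrDr mulrA lerD// ?ler_piMl//.
  by rewrite ler_pM2r ?invr_gt0.
(* A negative [k] arises for large [theta0]; the left side is then nonpositive. *)
apply: (@le_trans _ _ 0).
  rewrite nmulr_rle0// mulr_ge0//; first lra.
  apply: ub_le_sup; first by apply: Ustar_has_ubound => i; exact: ltW.
  exists (fun=> 0); split; first by move=> i; rewrite lexx ler01.
  by split; [|]; rewrite big1 ?(ltW B_gt0)// => i _; rewrite mulr0.
rewrite addr_ge0// divr_ge0 ?(ltW r0)//; apply: sumr_ge0 => i _.
by rewrite mulr_ge0 ?(ltW (u_gt0 i))// (Qr_ge0 (@standard_f_ln R)).
Qed.

Lemma continuous_total_payment r : 0 < r ->
  {for r, continuous (fun s : R => \sum_(i < n) u i *
    (s * (e * ln (Num.max 1 (e - c i / u i / s)) + 1 -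
     Num.max 1 (e - c i / u i / s))))}.
Proof.
move=> r0.
have cq i : {for r, continuous (fun s : R => e - c i / u i / s)}.
  apply: cvgB; first exact: cvg_cst.
  by apply: cvgM; [exact: cvg_cst|apply: cvgV; [rewrite gt_eqF|exact: cvg_id]].
apply: cvg_big => [|i _]; first by move=> z; exact: add_continuous.
apply: cvgM; first exact: cvg_cst.
apply: cvgM; first exact: cvg_id.
apply: cvgB; last first.
  apply: (@continuous_max R _ (fun=> 1) (fun s : R => e - c i / u i / s)) => //.
  exact: cvg_cst.
apply: cvgD; last exact: cvg_cst.
apply: cvgM; first exact: cvg_cst.
exact: (@continuous_ln_max R (fun s : R => e - c i / u i / s)).
Qed.

(** If the payment at the supremum were below [B], continuity would put a strictly larger rate in
    the stop set. *)
Lemma total_payment_sup_ge :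
  has_ubound (stop_set f u c B) -> 0 < sup (stop_set f u c B) ->
  B <= total_payment f u c (sup (stop_set f u c B)).
Proof.
set S := stop_set f u c B => ubS s0; rewrite leNgt; apply/negP => sB.
set H := fun s : R => \sum_(i < n) u i *
    (s * (e * ln (Num.max 1 (e - c i / u i / s)) + 1 -
     Num.max 1 (e - c i / u i / s))).
have HE r : 0 < r -> total_payment f u c r = H r.
  by move=> r0; apply: eq_bigr => i _; rewrite /Pr Qr_f_ln.
have cH := @continuous_total_payment _ s0.
rewrite HE// in sB.
have nB : \forall r \near (sup S)^'+, H r < B.
  exact: (cvgr_lt (H (sup S)) (cvg_at_right_filter cH) B sB).
have [r [/= rs rB]] : exists r, sup S < r /\ H r < B.
  apply: (@filter_ex _ (sup S)^'+); near=> r; split; near: r => //.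
  exact: nbhs_right_gt.
have : r <= sup S.
  apply: ub_le_sup => //; have r0 : 0 < r by exact: lt_trans rs.
  by split=> //; rewrite HE// ltW.
by rewrite leNgt rs.
Unshelve. all: by end_near. Qed.

Lemma total_payment_zero_at_le i r : 0 < r ->
  total_payment f u (zero_at c i) r <= total_payment f u c r + (e - 1) * c i.
Proof.
move=> r0; rewrite /total_payment (bigD1 i)//= [in leRHS](bigD1 i)//=.
rewrite (eq_bigr (fun j => Pr f r (u j) (c j))); last first.
  by move=> j ji; rewrite /zero_at (negbTE ji).
rewrite /zero_at eqxx addrAC lerD2r /Pr mul0r.
have := Qr0_sub_f_ln r0 (cu_ge0 i).
rewrite -(ler_pM2l (u_gt0 i)) mulrBr mulrCA [u i * (c i / u i)]mulrCA.
rewrite divff ?gt_eqF// mulr1; lra.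
Qed.

(** At cost zero seller [i] alone is paid [u i * r], so the degenerate branch of [truthful] never
    occurs here. *)
Lemma stop_set_bounded i : has_ubound (stop_set f u (zero_at c i) B).
Proof.
exists (B / u i) => r [r0 rB]; rewrite ler_pdivlMr// mulrC.
apply: le_trans rB; rewrite /total_payment (bigD1 i)//=.
rewrite {1}/Pr {1}/zero_at eqxx mul0r Qr0_f_ln// lerDl.
apply: sumr_ge0 => j _; rewrite mulr_ge0 ?(ltW (u_gt0 j))//.
by rewrite (Qr_ge0 (@standard_f_ln R))// divr_ge0 ?zero_at_ge0// ltW.
Qed.

End LowerBound.

Lemma truthful_f_ln_ge (R : realType) (n : nat) (u c : 'I_n -> R) (B theta0 : R) :
  valid_instance u c B -> largeness c B <= theta0 ->
  (1 - expR (-1)) * (1 - (@euler R - 1) * theta0) * Ustar u c B <=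
  mech_utility (truthful (@f_ln R)) u c B.
Proof.
move=> [n0 [B0 [u0 c0]]] ltheta; have e2 := euler_gt2 R.
set k := 1 - (euler R - 1) * theta0.
have cB i : c i <= theta0 * B.
  by move: ltheta; rewrite /largeness ler_pdivrMr//; apply: le_trans; exact: le_bigmax.
have t0 : 0 <= theta0.
  have /= := le_trans (c0 (Ordinal n0)) (cB (Ordinal n0)).
  by rewrite pmulr_lge0.
pose r i := sup (stop_set (@f_ln R) u (zero_at c i) B).
have r0 i : 0 < r i.
  have [s Ss] := stop_set_neq0 (@standard_f_ln R) u0 (zero_at_ge0 c0 i) B0.
  have [s0 _] := Ss.
  by apply: lt_le_trans s0 _; apply: ub_le_sup => //; exact: stop_set_bounded.
have rk i : k * B <= total_payment (@f_ln R) u c (r i).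
  have := total_payment_sup_ge u0 (zero_at_ge0 c0 i)
    (stop_set_bounded B u0 c0 i) (r0 i).
  rewrite -/(r i) => /le_trans/(_ (total_payment_zero_at_le u0 c0 i (r0 i))).
  have : (euler R - 1) * c i <= (euler R - 1) * (theta0 * B).
    by rewrite ler_wpM2l//; lra.
  rewrite /k; lra.
(* A single rate is needed for duality; the least one underestimates every allocation and, being one
   of the [r i], keeps the payment bound. *)
pose s := \big[Num.min/r (Ordinal n0)]_i r i.
have [s0 sk] : 0 < s /\ k * B <= total_payment (@f_ln R) u c s.
  apply: (big_ind (fun s => 0 < s /\ k * B <= total_payment (@f_ln R) u c s)) => //.
  by move=> x y ? ?; rewrite minEle; case: ifP.
have k1 : k <= 1 by rewrite /k lerBlDr lerDl mulr_ge0//; lra.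
apply: le_trans (utility_ge B0 u0 c0 s0 k1 sk) _.
apply: ler_sum => i _; rewrite ler_pM2l// /truthful.
case: asboolP => [_|]; last by case; exact: stop_set_bounded.
have cu0 : 0 <= c i / u i by rewrite divr_ge0// ltW.
rewrite -/(r i) /frate (rule_noninc (@standard_f_ln R))//.
  by rewrite divr_ge0 ?(ltW (r0 i)).
by rewrite ler_wpM2l// lef_pV2 ?posrE// bigmin_le.
Qed.

Lemma worst_ratio_f_ln_ge (R : realType) (theta0 : R) :
  (((1 - expR (-1)) * (1 - (@euler R - 1) * theta0))%:E <=
  worst_ratio (truthful (@f_ln R)) theta0)%E.
Proof.
apply: le_ereal_inf_tmp => _ [n [u [c [B [v [l ->]]]]]].
have [n0 [B0 [u0 c0]]] := v.
by rewrite lee_fin ler_pdivlMr ?Ustar_gt0// truthful_f_ln_ge.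
Qed.

Theorem theorem1 (R : realType) :
  standard_rule (@f_ln R) /\
  large_market_ratio_is (truthful (@f_ln R)) (1 - expR (-1))%:E /\
  (forall g : R -> R, standard_rule g ->
     exists l : \bar R, large_market_ratio_is (truthful g) l /\
                        (l <= (1 - expR (-1))%:E)%E).
Proof.
split; first exact: standard_f_ln.
split; last first.
  move=> g hg; apply: large_market_ratio_exists => theta0.
  exact: worst_ratio_le.
apply: (@squeeze_cvge _ _ _ _
  (fun x => ((1 - expR (-1)) * (1 - (euler R - 1) * x))%:E) _
  (fun=> (1 - expR (-1))%:E)).
- near=> x; rewrite worst_ratio_f_ln_ge worst_ratio_le//.
  exact: standard_f_ln.
- apply: cvg_EFin; first by near=> x.
  (* The limit is rewritten as the value at 0 of the lower bound, whose continuity then gives the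
     convergence. *)
  have {2}-> : 1 - expR (-1) = (1 - expR (-1)) * (1 - (euler R - 1) * 0) :> R.
    by rewrite mulr0 subr0 mulr1.
  apply: cvg_at_right_filter; apply: cvgM; first exact: cvg_cst.
  apply: cvgB; first exact: cvg_cst.
  by apply: cvgM; [exact: cvg_cst|exact: cvg_id].
- exact: cvg_cst.
Unshelve. all: by end_near. Qed.
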